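(* For a complete lattice $B$, the following conditions are equivalent: (a) $B$ is atomic and boolean. (b) $B$ is atomistic and pseudocomplemented. (c) $B\,\check\otimes\,B\simeq B\otimes B\simeq Gal(B,B)$ is a unital quantale. (d) $B\,\check\otimes\,B$ is isomorphic to the quantale of all relations on a set.
   Context: A quantale is a complete lattice with an associative multiplication distributing over arbitrary joins on both sides; it is unital if the multiplication has a two-sided neutral element. The quantale of all relations on a set $S$ is $\mathcal{P}(S\times S)$ ordered by inclusion with the relation product $R\cdot R'=\{(a,c):\exists b\ (a,b)\in R,(b,c)\in R'\}$. Let $0$ be the least element of $B$ and $\check B=B\setminus\{0\}$. $B$ is atomic if below every nonzero element there is an atom (a minimal element of $\check B$), atomistic if every element is a join of atoms, and pseudocomplemented if for each $x$ there is a greatest $y$ with $x\wedge y=0$. $B\,\check\otimes\,B$ is the set, ordered by inclusion, of all down-sets $T$ of $\check B\times\check B$ such that $X\times Y\subseteq T$ implies $(\bigvee X,\bigvee Y)\in T$ for all nonempty $X,Y\subseteq\check B$. Its multiplication is: $R\odot S$ is the least member of $B\,\check\otimes\,B$ containing the relation product $R\cdot S$. $B\otimes B$ is the set, ordered by inclusion, of all down-sets $T$ of $B\times B$ such that $X\times Y\subseteq T$ implies $(\bigvee X,\bigvee Y)\in T$ for all $X,Y\subseteq B$. $Gal(B,B)$ is the pointwise ordered set of all maps $f:B\to B$ with $f(\bigvee X)=\bigwedge f[X]$ for all $X\subseteq B$. These are isomorphic complete lattices via $T\mapsto T\setminus((\{0\}\times B)\cup(B\times\{0\}))$ from $B\otimes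 B$ to $B\,\check\otimes\,B$ and $f\mapsto\{(x,y)\in\check B\times\check B: f(x)\ge y\}$ from $Gal(B,B)$ to $B\,\check\otimes\,B$; the multiplications of $B\otimes B$ and $Gal(B,B)$ are those transported from $B\,\check\otimes\,B$ along these isomorphisms. *)

(* Defs.v *)
From HB Require Import structures.
From mathcomp Require Import all_boot all_order.
From mathcomp Require Import all_classical.

Set Implicit Arguments.
Unset Strict Implicit.
Unset Printing Implicit Defensive.

Import Order.TTheory.
Local Open Scope order_scope.
Local Open Scope classical_set_scope.

Definition complete_order d (Q : porderType d) : Prop :=
  forall X : set Q, supremums X !=set0.

HB.mixin Record isComplete d T of Order.TBLattice d T := {
  complete_subproof : complete_order T
}.

#[short(type="completeLatticeType")]
HB.structure Definition CompleteLattice d :=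
  { T of Order.TBLattice d T & isComplete d T }.

(* The first argument of supremum and infimum is their value at set0. *)
Definition bigjoin d (B : completeLatticeType d) (X : set B) : B :=
  supremum \bot X.

Definition bigmeet d (B : completeLatticeType d) (X : set B) : B :=
  infimum \top X.

Section BigJoinMeet.
Context {d : Order.disp_t} {B : completeLatticeType d}.
Implicit Types (X Y : set B) (x y : B).

Lemma bigjoin_supremums X : supremums X (bigjoin X).
Proof.
rewrite /bigjoin /supremum; case: ifPn => [/eqP ->|_].
  by split => [x //|y _]; exact: le0x.
by case: xgetP => // X0; have [s /X0] := complete_subproof X.
Qed.

Lemma bigjoin_leP X y : bigjoin X <= y <-> ubound X y.
Proof.
have [ub lub] := bigjoin_supremums X.
by split=> [Xy x Xx|/lub //]; exact: le_trans (ub x Xx) Xy.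
Qed.

Lemma le_bigjoin X x : X x -> x <= bigjoin X.
Proof. by move=> Xx; have [ub _] := bigjoin_supremums X; exact: ub. Qed.

Lemma bigmeet_infimums X : infimums X (bigmeet X).
Proof.
rewrite /bigmeet /infimum; case: ifPn => [/eqP ->|_].
  by split => [x //|y _]; exact: lex1.
case: xgetP => // X0; exfalso; apply: (X0 (bigjoin (lbound X))); split.
  by move=> x Xx; apply/bigjoin_leP => y; exact.
by move=> y Xy; exact: le_bigjoin.
Qed.

Lemma le_bigmeetP X y : y <= bigmeet X <-> lbound X y.
Proof.
have [lb glb] := bigmeet_infimums X.
by split=> [Xy x Xx|/glb //]; exact: le_trans Xy (lb x Xx).
Qed.

Lemma bigjoin1 x : bigjoin [set x] = x.
Proof. exact: supremum1. Qed.

Lemma bigjoin0 : bigjoin set0 = \bot :> B.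
Proof. exact: supremum0. Qed.

Lemma eq_from_le x y : (forall z, (z <= x) = (z <= y)) -> x = y.
Proof.
by move=> e; apply/eqP; rewrite eq_le -e lexx e lexx.
Qed.

End BigJoinMeet.

Section LatticeProperties.
Context {d : Order.disp_t}.

Definition atom {B : tbLatticeType d} (a : B) : Prop :=
  a != \bot /\ forall b : B, b != \bot -> b <= a -> b = a.

Definition atomic (B : tbLatticeType d) : Prop :=
  forall x : B, x != \bot -> exists2 a, atom a & a <= x.

Definition atomistic (B : completeLatticeType d) : Prop :=
  forall x : B, exists2 A : set B, A `<=` atom & x = bigjoin A.

Definition pseudocomplemented (B : tbLatticeType d) : Prop :=
  forall x : B, exists2 y : B,
    (x `&` y)%O = \bot & forall z : B, (x `&` z)%O = \bot -> z <= y.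

Definition boolean (B : tbLatticeType d) : Prop :=
  left_distributive (@Order.meet d B) (@Order.join d B) /\
  forall x : B, exists2 y : B, (x `&` y)%O = \bot & (x `|` y)%O = \top.

End LatticeProperties.

Section Quantales.
Context {d d' : Order.disp_t}.

Definition quantale (Q : porderType d) (mul : Q -> Q -> Q) : Prop :=
  [/\ complete_order Q,
      associative mul,
      forall (a : Q) (X : set Q) (s : Q),
        supremums X s -> supremums [set mul a x | x in X] (mul a s) &
      forall (a : Q) (X : set Q) (s : Q),
        supremums X s -> supremums [set mul x a | x in X] (mul s a)].

Definition unital_quantale (Q : porderType d) (mul : Q -> Q -> Q) : Prop :=
  quantale mul /\ exists e : Q, left_id e mul /\ right_id e mul.

Definition quantale_iso (Q : porderType d) (Q' : porderType d')
    (mul : Q -> Q -> Q) (mul' : Q' -> Q' -> Q') (f : Q -> Q') : Prop :=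
  [/\ bijective f,
      {mono f : x y / x <= y} &
      {morph f : x y / mul x y >-> mul' x y}].

End Quantales.

(* The library composition "_ \; _" has the factor applied first on the right. *)
Definition relprod (S : Type) (R R' : set (S * S)) : set (S * S) :=
  (R' \; R)%relation.

Lemma relprodE (S : Type) (R R' : set (S * S)) (a c : S) :
  relprod R R' (a, c) <-> exists b, R (a, b) /\ R' (b, c).
Proof. by split=> [[b]|[b []]]; exists b. Qed.

Section TensorProducts.
Context {d : Order.disp_t} (B : completeLatticeType d).

(* The elements of \check B. *)
Definition nonbot : set B := [set x | x != \bot].

(* A down-set of \check B x \check B is represented by a subset of B x B
   that is contained in \check B x \check B. *)
Definition is_check_tensor (T : set (B * B)) : Prop :=
  [/\ T `<=` nonbot `*` nonbot,
      forall x y x' y' : B, T (x, y) -> nonbot x' -> nonbot y' ->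
        x' <= x -> y' <= y -> T (x', y') &
      forall X Y : set B, X !=set0 -> Y !=set0 ->
        X `<=` nonbot -> Y `<=` nonbot ->
        X `*` Y `<=` T -> T (bigjoin X, bigjoin Y)].

Definition is_tensor (T : set (B * B)) : Prop :=
  (forall x y x' y' : B, T (x, y) -> x' <= x -> y' <= y -> T (x', y')) /\
  (forall X Y : set B, X `*` Y `<=` T -> T (bigjoin X, bigjoin Y)).

Definition is_gal (f : B -> B) : Prop :=
  forall X : set B, f (bigjoin X) = bigmeet (f @` X).

Record check_tensor := CheckTensor {
  check_tensor_val :> set (B * B);
  _ : `[< is_check_tensor check_tensor_val >] }.

Record tensor := Tensor {
  tensor_val :> set (B * B);
  _ : `[< is_tensor tensor_val >] }.

Record gal := Gal {
  gal_val :> B -> B;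
  _ : `[< is_gal gal_val >] }.

HB.instance Definition _ := [isSub of check_tensor for check_tensor_val].
HB.instance Definition _ := [Choice of check_tensor by <:].
HB.instance Definition _ :=
  [SubChoice_isSubPOrder of check_tensor by <: with set_display].

HB.instance Definition _ := [isSub of tensor for tensor_val].
HB.instance Definition _ := [Choice of tensor by <:].
HB.instance Definition _ :=
  [SubChoice_isSubPOrder of tensor by <: with set_display].

HB.instance Definition _ := [isSub of gal for gal_val].
HB.instance Definition _ := [Choice of gal by <:].
HB.instance Definition _ :=
  [SubChoice_isSubPOrder of gal by <: with FunOrder.fun_display].

Lemma check_tensorP (T : check_tensor) : is_check_tensor T.
Proof. by case: T => T /= /asboolP. Qed.

Lemma tensorP (T : tensor) : is_tensor T.
Proof. by case: T => T /= /asboolP. Qed.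

Lemma galP (f : gal) : is_gal f.
Proof. by case: f => f /= /asboolP. Qed.

Lemma check_tensor_leP (R S : check_tensor) :
  R <= S <-> (R : set (B * B)) `<=` S.
Proof. by split=> /asboolP. Qed.

Lemma tensor_leP (R S : tensor) : R <= S <-> (R : set (B * B)) `<=` S.
Proof. by split=> /asboolP. Qed.

Lemma gal_leP (f g : gal) : f <= g <-> forall x : B, f x <= g x.
Proof. by split=> /asboolP. Qed.

Lemma nonbotP (x : B) : x = \bot \/ nonbot x.
Proof. by rewrite /nonbot /=; have [->|] := eqVneq x \bot; [left|right]. Qed.

Lemma nonbot_le (x y : B) : nonbot x -> x <= y -> nonbot y.
Proof.
by rewrite /nonbot /= => x0 xy; apply: contraNneq x0 => y0; rewrite -lex0 -y0.
Qed.

Lemma bigjoin_nonbot (X : set B) :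
  X !=set0 -> X `<=` nonbot -> nonbot (bigjoin X).
Proof. by move=> [x Xx] /(_ x Xx) x0; exact: nonbot_le x0 (le_bigjoin Xx). Qed.

Lemma nonbot_is_check_tensor : is_check_tensor (nonbot `*` nonbot).
Proof.
by split=> [//|x y x' y' _ //|X Y X0 Y0 Xn Yn _]; split; exact: bigjoin_nonbot.
Qed.

Lemma smallest_is_check_tensor (G : set (B * B)) : G `<=` nonbot `*` nonbot ->
  is_check_tensor (smallest is_check_tensor G).
Proof.
move=> Gn; split=> [xy|x y x' y' Txy x0 y0 xx yy|X Y X0 Y0 Xn Yn XY].
- by apply; split => //; exact: nonbot_is_check_tensor.
- by move=> M [Mt GM]; have [_ + _] := Mt; apply; [exact: Txy| | | |].
- move=> M [Mt GM]; have [_ _] := Mt; apply => //.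
  by move=> xy /XY; exact.
Qed.

Lemma relprod_nonbot (R S : check_tensor) :
  relprod R S `<=` nonbot `*` nonbot.
Proof.
have [Rn _ _] := check_tensorP R; have [Sn _ _] := check_tensorP S.
by move=> [x z] [y /Rn [x0 _] /Sn [_ z0]]; split.
Qed.

Definition check_mul (R S : check_tensor) : check_tensor :=
  CheckTensor (asboolT (smallest_is_check_tensor (@relprod_nonbot R S))).

Lemma check_mul_least (R S : check_tensor) :
  relprod R S `<=` check_mul R S /\
  (forall T : check_tensor, relprod R S `<=` T -> check_mul R S <= T).
Proof.
split; first exact: sub_smallest.
move=> T RST; apply/check_tensor_leP; apply: smallest_sub RST.
exact: check_tensorP.
Qed.

Definition botcross : set (B * B) :=
  [set \bot] `*` setT `|` setT `*` [set \bot].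

Lemma botcrossP (x y : B) : botcross (x, y) <-> x = \bot \/ y = \bot.
Proof. by split=> [[[]|[]]|[]] /=; [left|right|left|right]. Qed.

Lemma botcrossN (x y : B) : ~ botcross (x, y) <-> nonbot x /\ nonbot y.
Proof.
rewrite botcrossP not_orP /nonbot /=.
by split=> [[/eqP ? /eqP ?]|[/eqP ? /eqP ?]].
Qed.

Lemma tensor_botcross (T : set (B * B)) : is_tensor T -> botcross `<=` T.
Proof.
move=> [_ TJ] [x y] /botcrossP [->|->].
  by rewrite -bigjoin0 -(bigjoin1 y); apply: TJ => -[? ?] [].
by rewrite -bigjoin0 -(bigjoin1 x); apply: TJ => -[? ?] [].
Qed.

Lemma tensor_setD_is_check_tensor (T : set (B * B)) :
  is_tensor T -> is_check_tensor (T `\` botcross).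
Proof.
move=> [Td TJ]; split.
- by move=> [x y] [_ /botcrossN].
- move=> x y x' y' [Txy _] x0 y0 xx yy; split; last exact/botcrossN.
  exact: Td Txy xx yy.
- move=> X Y X0 Y0 Xn Yn XY; split.
    by apply: TJ => xy /XY [].
  by apply/botcrossN; split; exact: bigjoin_nonbot.
Qed.

Lemma bigjoin_nonbotI (X : set B) : bigjoin (X `&` nonbot) = bigjoin X.
Proof.
apply/eqP; rewrite eq_le; apply/andP; split; apply/bigjoin_leP => x.
  by move=> [Xx _]; exact: le_bigjoin.
by move=> Xx; have [->|x0] := nonbotP x; [exact: le0x|apply: le_bigjoin].
Qed.

Lemma check_tensor_setU_is_tensor (T : set (B * B)) :
  is_check_tensor T -> is_tensor (T `|` botcross).
Proof.
move=> [Tn Td TJ]; split.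
  move=> x y x' y' Txy xx yy.
  have [x'0|x'n] := nonbotP x'; first by right; apply/botcrossP; left.
  have [y'0|y'n] := nonbotP y'; first by right; apply/botcrossP; right.
  case: Txy => [Txy|/botcrossP xy0]; first by left; exact: Td Txy _ _ xx yy.
  have xn := nonbot_le x'n xx; have yn := nonbot_le y'n yy.
  by case/botcrossN: (conj xn yn); exact/botcrossP.
move=> X Y XY; rewrite -(bigjoin_nonbotI X) -(bigjoin_nonbotI Y).
have [->|/set0P X0] := eqVneq (X `&` nonbot) set0.
  by right; apply/botcrossP; left; rewrite bigjoin0.
have [->|/set0P Y0] := eqVneq (Y `&` nonbot) set0.
  by right; apply/botcrossP; right; rewrite bigjoin0.
left; apply: TJ => // -[x y] [[Xx x0] [Yy y0]].
by have [//|] := XY (x, y) (conj Xx Yy); have /botcrossN := conj x0 y0.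
Qed.

Definition tensor_to_check (T : tensor) : check_tensor :=
  CheckTensor (asboolT (tensor_setD_is_check_tensor (tensorP T))).

Definition tensor_of_check (T : check_tensor) : tensor :=
  Tensor (asboolT (check_tensor_setU_is_tensor (check_tensorP T))).

Lemma tensor_to_checkK : cancel tensor_to_check tensor_of_check.
Proof.
move=> T; apply/val_inj/seteqP; split=> xy /=.
  by move=> [[]//|]; apply: tensor_botcross; exact: tensorP.
by move=> Txy; have [|] := pselect (botcross xy); [right|left].
Qed.

Lemma tensor_of_checkK : cancel tensor_of_check tensor_to_check.
Proof.
move=> T; have [Tn _ _] := check_tensorP T.
apply/val_inj/seteqP; split=> -[x y] /=; first by move=> [[]].
by move=> Txy; split; [left|apply/botcrossN; exact: Tn Txy].
Qed.

Lemma gal_is_check_tensor (f : B -> B) : is_gal f ->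
  is_check_tensor [set xy | [/\ nonbot xy.1, nonbot xy.2 & xy.2 <= f xy.1]].
Proof.
move=> fG; split=> [[x y] [] //||].
  move=> x y x' y' [/= x0 y0 yfx] x'0 y'0 xx yy; split=> //=.
  apply: le_trans yy (le_trans yfx _).
  have -> : x = bigjoin [set x; x'].
    apply/eqP; rewrite eq_le le_bigjoin /=; last by left.
    by apply/bigjoin_leP => z [->//|->].
  have /le_bigmeetP := lexx (bigmeet (f @` [set x; x'])).
  by rewrite fG; apply; exists x' => //; right.
move=> X Y X0 Y0 Xn Yn XY; split=> /=; [exact: bigjoin_nonbot..|].
rewrite fG; apply/le_bigmeetP => _ [x Xx <-]; apply/bigjoin_leP => y Yy.
by have [] := XY (x, y) (conj Xx Yy).
Qed.

Definition gal_to_check (f : gal) : check_tensor :=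
  CheckTensor (asboolT (gal_is_check_tensor (galP f))).

Lemma le_bigjoin_section (T : set (B * B)) (x y : B) : is_tensor T ->
  y <= bigjoin [set z | T (x, z)] <-> T (x, y).
Proof.
move=> [Td TJ]; split=> [yT|Txy]; last exact: le_bigjoin.
have : T (bigjoin [set x], bigjoin [set z | T (x, z)]).
  by apply: TJ => -[? z] [/= -> ].
by rewrite bigjoin1 => /Td; apply.
Qed.

Lemma section_is_gal (T : set (B * B)) : is_tensor T ->
  is_gal (fun x => bigjoin [set y | T (x, y)]).
Proof.
move=> Tt; have [Td TJ] := Tt; move=> X; apply: eq_from_le => y.
apply/idP/idP => [/(le_bigjoin_section _ _ Tt) TXy|yX].
  apply/le_bigmeetP => _ [x Xx <-]; apply/(le_bigjoin_section _ _ Tt).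
  by apply: Td TXy _ _ => //; exact: le_bigjoin.
apply/(le_bigjoin_section _ _ Tt); rewrite -(bigjoin1 y).
apply: TJ => -[x _] [/= Xx ->]; apply/(le_bigjoin_section _ _ Tt).
by move/le_bigmeetP : yX; apply; exists x.
Qed.

Definition gal_of_check (T : check_tensor) : gal :=
  Gal (asboolT (section_is_gal (tensorP (tensor_of_check T)))).

Lemma gal_bot (f : gal) : f \bot = \top.
Proof.
rewrite -bigjoin0 galP image_set0; apply/eqP; rewrite -le1x.
by apply/le_bigmeetP => ? [].
Qed.

Lemma gal_to_checkK : cancel gal_to_check gal_of_check.
Proof.
move=> f; apply/val_inj/funext => x; apply: eq_from_le => y.
apply/idP/idP => /=.
  move=> /(le_bigjoin_section _ _ (tensorP (tensor_of_check (gal_to_check f)))).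
  move=> [[]//|/botcrossP [->|->]]; [by rewrite gal_bot lex1|exact: le0x].
move=> yfx.
apply/(le_bigjoin_section _ _ (tensorP (tensor_of_check (gal_to_check f)))) => /=.
have [xy0|/botcrossN [x0 y0]] := pselect (botcross (x, y)); first by right.
by left.
Qed.

Lemma gal_of_checkK : cancel gal_of_check gal_to_check.
Proof.
move=> T; have [Tn _ _] := check_tensorP T.
have sT x y := le_bigjoin_section x y (tensorP (tensor_of_check T)).
apply/val_inj/seteqP; split=> -[x y] /=.
  by move=> [x0 y0 /sT [//|]]; have /botcrossN := conj x0 y0.
by move=> Txy; have [/= x0 y0] := Tn _ Txy; split=> //; apply/sT; left.
Qed.

Definition tensor_mul (R S : tensor) : tensor :=
  tensor_of_check (check_mul (tensor_to_check R) (tensor_to_check S)).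

Definition gal_mul (f g : gal) : gal :=
  gal_of_check (check_mul (gal_to_check f) (gal_to_check g)).

Lemma tensor_to_check_iso : quantale_iso tensor_mul check_mul tensor_to_check.
Proof.
split.
- by exists tensor_of_check; [exact: tensor_to_checkK|exact: tensor_of_checkK].
- move=> R S; apply/idP/idP => /asboolP RS; apply/asboolP => xy /=.
    move=> Rxy; have [|nxy] := pselect (botcross xy).
      by apply: tensor_botcross; exact: tensorP.
    by have [] := RS xy (conj Rxy nxy).
  by move=> [Rxy nxy]; split=> //; exact: RS.
- by move=> R S; exact: tensor_of_checkK.
Qed.

Lemma gal_to_check_iso : quantale_iso gal_mul check_mul gal_to_check.
Proof.
split.
- by exists gal_of_check; [exact: gal_to_checkK|exact: gal_of_checkK].
- move=> f g; apply/idP/idP => [/asboolP fg|/gal_leP fg].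
    apply/gal_leP => x.
    have [->|x0] := nonbotP x; first by rewrite !gal_bot.
    have [->|fx0] := nonbotP (f x); first exact: le0x.
    by have [] := fg (x, f x) (And3 x0 fx0 (lexx _)).
  apply/asboolP => -[x y] [/= x0 y0 yfx]; split=> //=.
  exact: le_trans yfx (fg x).
- by move=> f g; exact: gal_of_checkK.
Qed.

End TensorProducts.

(* Main.v *)
Require Import Defs.
From mathcomp Require Import all_boot all_order.
From mathcomp Require Import all_classical.

(** Everything rests on the behaviour of atoms.  If [B] is atomistic and
    pseudocomplemented, every atom is completely prime ([atom_prime]): an atom
    that is below no member of a set [X] is disjoint from all of them, so its
    pseudocomplement bounds [X].  An element is then determined by the atoms
    below it, joins correspond to unions, and [B] is a powerset up to
    isomorphism.  Hence [B] is boolean, and restricting a tensor to pairs of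
    atoms identifies the tensors with the relations on the set of atoms, the
    multiplication becoming the relation product ([restrict_to_atoms_iso]).
    The relations on a set form a unital quantale, and this structure is
    transported along isomorphisms.

    The converse, from a unital quantale of tensors back to [B], uses the
    rectangles [rect x y], the tensors generated by a single pair.

    - Multiplying a unit [E] by rectangles shows that [E] contains only
      diagonal pairs [(a, a)].  As [E] is a down-set, such an [a] is an atom;
      that [E] also fixes the rectangles [rect x \top] says that [x] is the
      join of such atoms below it.

    - If [Z] is the set of all elements disjoint from [x], then [rect \top x]
      annihilates all [rect z \top] with [z] in [Z].  By distributivity it
      annihilates their join [rect (bigjoin Z) \top], which means that
      [bigjoin Z] is disjoint from [x]. *)

Set Implicit Arguments.
Unset Strict Implicit.
Unset Printing Implicit Defensive.

Import Order.TTheory.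
Local Open Scope order_scope.
Local Open Scope classical_set_scope.

(** * Suprema and order isomorphisms *)

Section Suprema.
Context {d d' : Order.disp_t}.

Lemma supremums_unique (Q : porderType d) (X : set Q) (s t : Q) :
  supremums X s -> supremums X t -> s = t.
Proof.
by move=> [sX sl] [tX tl]; apply/le_anti; rewrite sl // tl.
Qed.

Lemma supremums_mono (Q : porderType d) (Q' : porderType d') (f : Q -> Q')
    (X : set Q) (s : Q) :
  bijective f -> {mono f : x y / x <= y} ->
  supremums (f @` X) (f s) <-> supremums X s.
Proof.
move=> [g fK gK] fm; split=> -[ub lub]; split.
- by move=> x Xx; rewrite -fm; apply: ub; exists x.
- move=> y yX; rewrite -fm; apply: lub => _ [x Xx <-]; rewrite fm; exact: yX.
- by move=> _ [x Xx <-]; rewrite fm; exact: ub.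
- move=> y yX; rewrite -(gK y) fm; apply: lub => x Xx.
  by rewrite -fm gK; apply: yX; exists x.
Qed.

Lemma quantale_iso_unital (Q : porderType d) (Q' : porderType d')
    (mul : Q -> Q -> Q) (mul' : Q' -> Q' -> Q') (f : Q -> Q') :
  quantale_iso mul mul' f -> unital_quantale mul' -> unital_quantale mul.
Proof.
move=> [fb fm fM] [[Qc mA mDr mDl] [e [e1 e2]]].
have [g fK gK] := fb; have fI := can_inj fK.
split; last first.
  by exists (g e); split=> x; apply: fI; rewrite fM gK ?e1 ?e2.
split.
- move=> X; have [s Xs] := Qc (f @` X); exists (g s).
  by apply/(supremums_mono _ _ fb fm); rewrite gK.
- by move=> x y z; apply: fI; rewrite !fM mA.
- move=> a X s /(supremums_mono _ _ fb fm) /(mDr (f a)) Xs.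
  apply/(supremums_mono _ _ fb fm); rewrite fM; move: Xs.
  by rewrite !image_comp /comp; under eq_fun do rewrite -fM.
- move=> a X s /(supremums_mono _ _ fb fm) /(mDl (f a)) Xs.
  apply/(supremums_mono _ _ fb fm); rewrite fM; move: Xs.
  by rewrite !image_comp /comp; under eq_fun do rewrite -fM.
Qed.

End Suprema.

(** * The quantale of relations *)

Section Relations.
Context {S : Type}.
Implicit Types (R : set (S * S)) (X : set (set (S * S))).

Lemma supremums_bigcup X : supremums X (\bigcup_(R in X) R).
Proof.
split=> [R XR|R RX]; apply/asboolP; first exact: bigcup_sup.
by apply: bigcup_sub => R' /RX /asboolP.
Qed.

Lemma relprod_unital_quantale : unital_quantale (@relprod S).
Proof.
split; last first.
  exists [set p | p.1 = p.2]; split=> R; apply/seteqP; split=> -[a b].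
  - by move=> /relprodE [c [/= -> ]].
  - by move=> Rab; apply/relprodE; exists a.
  - by move=> /relprodE [c [? /= <-]].
  - by move=> Rab; apply/relprodE; exists b.
split.
- by move=> X; exists (\bigcup_(R in X) R); exact: supremums_bigcup.
- move=> R1 R2 R3; apply/seteqP; split=> -[a b].
    move=> /relprodE [c [ac /relprodE [e [ce eb]]]].
    by apply/relprodE; exists e; split=> //; apply/relprodE; exists c.
  move=> /relprodE [c [/relprodE [e [ae ec]] cb]].
  by apply/relprodE; exists e; split=> //; apply/relprodE; exists c.
- move=> R X s /(supremums_unique (supremums_bigcup X)) <-.
  suff -> : relprod R (\bigcup_(R' in X) R') =
            \bigcup_(R' in [set relprod R R' | R' in X]) R'.
    exact: supremums_bigcup.
  apply/seteqP; split=> -[a b].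
    move=> /relprodE [c [ac [R' XR' cb]]].
    by exists (relprod R R'); [exists R'|apply/relprodE; exists c].
  move=> [_ [R' XR' <-] /relprodE [c [ac cb]]].
  by apply/relprodE; exists c; split=> //; exists R'.
- move=> R X s /(supremums_unique (supremums_bigcup X)) <-.
  suff -> : relprod (\bigcup_(R' in X) R') R =
            \bigcup_(R' in [set relprod R' R | R' in X]) R'.
    exact: supremums_bigcup.
  apply/seteqP; split=> -[a b].
    move=> /relprodE [c [[R' XR' ac] cb]].
    by exists (relprod R' R); [exists R'|apply/relprodE; exists c].
  move=> [_ [R' XR' <-] /relprodE [c [ac cb]]].
  by apply/relprodE; exists c; split=> //; exists R'.
Qed.

End Relations.

(** * Atoms *)

Section Atoms.
Context {d : Order.disp_t} {B : completeLatticeType d}.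
Implicit Types (a x y : B) (X : set B).

Lemma meet_atom a x : atom a -> ~~ (a <= x) -> (a `&` x)%O = \bot.
Proof.
move=> [a0 amin] nax; apply/eqP; apply: contraNT nax => /amin ax.
by rewrite -[X in X <= _]ax ?leIl// leIr.
Qed.

(** The only possible obstruction is the meet of [x] with the complement of the
    join of the atoms below [x]: it contains no atom, hence vanishes. *)
Lemma atomic_boolean_atomistic : atomic B -> boolean B -> atomistic B.
Proof.
move=> at_B [meetUl compl] x.
pose A := [set a : B | atom a /\ a <= x]; exists A; first by move=> a [].
have Ax : bigjoin A <= x by apply/bigjoin_leP => a [].
apply/le_anti; rewrite Ax andbT.
have [y Ay0 Ay1] := compl (bigjoin A).
have [xy0|xy0] := eqVneq (x `&` y)%O \bot.
  by rewrite -(meet1x x) -Ay1 meetUl (meetC y) xy0 joinx0 leIl.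
have [a aat] := at_B _ xy0; rewrite lexI => /andP[ax ay].
have [a0 _] := aat; case/negP: a0.
by rewrite -lex0 -Ay0 lexI ay le_bigjoin.
Qed.

Lemma boolean_pseudocomplemented : boolean B -> pseudocomplemented B.
Proof.
move=> [meetUl compl] x; have [y xy0 xy1] := compl x; exists y => // z xz0.
by rewrite -(meet1x z) -xy1 meetUl xz0 join0x leIl.
Qed.

Section AtomisticPseudocomplemented.
Hypothesis B_atomistic : atomistic B.
Hypothesis B_pseudo : pseudocomplemented B.

Lemma le_atoms x y : (forall a, atom a -> a <= x -> a <= y) -> x <= y.
Proof.
have [A Aat ->] := B_atomistic x; move=> Ay; apply/bigjoin_leP => a Aa.
by apply: Ay; [exact: Aat|exact: le_bigjoin].
Qed.

Lemma atomistic_atomic : atomic B.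
Proof.
move=> x; have [A Aat xA] := B_atomistic x; rewrite xA.
have [->|/set0P [a Aa] _] := eqVneq A set0; first by rewrite bigjoin0 eqxx.
by exists a; [exact: Aat|exact: le_bigjoin].
Qed.

(** If no member of [X] is above [a], the pseudocomplement of [a] is above
    all of [X], hence above [a]. *)
Lemma atom_prime a X : atom a -> a <= bigjoin X -> exists2 x, X x & a <= x.
Proof.
move=> aat aX; apply: contrapT => nX.
have [y ay0 ymax] := B_pseudo a.
have Xy : bigjoin X <= y.
  apply/bigjoin_leP => x Xx; apply: ymax; apply: meet_atom => //.
  by apply/negP => ax; apply: nX; exists x.
by have [/negP[]] := aat; rewrite -lex0 -ay0 lexI lexx (le_trans aX).
Qed.

Lemma atom_le_join a x y : atom a -> a <= (x `|` y)%O -> a <= x \/ a <= y.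
Proof.
move=> aat axy; have : a <= bigjoin [set x; y].
  by apply: le_trans axy _; rewrite leUx !le_bigjoin//; [right|left].
by move=> /(atom_prime aat) [_ [->|->]]; [left|right].
Qed.

Lemma atomistic_boolean : boolean B.
Proof.
split=> [x y z|x].
  apply/le_anti/andP; split; apply: le_atoms => a aat.
    rewrite lexI => /andP[/(atom_le_join aat) [ax|ay] az].
      by rewrite lexU2// lexI ax az.
    by rewrite lexU2// !lexI ay az orbT.
  by move=> /(atom_le_join aat) []; rewrite !lexI => /andP[h ->];
    rewrite lexU2// h ?orbT.
have [y xy0 ymax] := B_pseudo x; exists y => //.
apply/le_anti; rewrite lex1; apply: le_atoms => a aat _.
have [ax|nax] := boolP (a <= x); first by rewrite lexU2// ax.
by rewrite lexU2// ymax ?orbT// meetC; exact: meet_atom.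
Qed.

Definition restrict_to_atoms (T : check_tensor B) :
    set ({a : B | atom a} * {a : B | atom a}) :=
  [set p | check_tensor_val T (sval p.1, sval p.2)].

Definition extend_from_atoms (R : set ({a : B | atom a} * {a : B | atom a})) :
    set (B * B) :=
  [set p | [/\ nonbot p.1, nonbot p.2 &
    forall a b : {a : B | atom a}, sval a <= p.1 -> sval b <= p.2 -> R (a, b)]].

Lemma extend_from_atoms_is_check_tensor R :
  is_check_tensor (extend_from_atoms R).
Proof.
split=> [[x y] []//|x y x' y' [_ _ Rxy] x'0 y'0 xx yy|X Y X0 Y0 Xn Yn XY].
  split=> // a b ax' by'; apply: Rxy => /=.
    exact: le_trans ax' xx.
  exact: le_trans by' yy.
split=> [||a b /= aX bY]; [exact: bigjoin_nonbot..|].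
have [x Xx ax] := atom_prime (svalP a) aX.
have [y Yy ay] := atom_prime (svalP b) bY.
by have [_ _] := XY (x, y) (conj Xx Yy); apply.
Qed.

Definition tensor_from_atoms R : check_tensor B :=
  CheckTensor (asboolT (@extend_from_atoms_is_check_tensor R)).

Lemma tensor_from_atomsK : cancel tensor_from_atoms restrict_to_atoms.
Proof.
move=> R; apply/seteqP; split=> -[a b] /=.
  by move=> [_ _]; apply.
move=> Rab; have [a0 _] := svalP a; have [b0 _] := svalP b.
split=> // a' b' /= aa bb.
have [_ /(_ _ (proj1 (svalP a')) aa) ea] := svalP a.
have [_ /(_ _ (proj1 (svalP b')) bb) eb] := svalP b.
have inj (u v : {a : B | atom a}) : sval u = sval v -> u = v.
  by case: u v => [u pu] [v pv] /= uv; exact: eq_exist.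
by rewrite (inj _ _ ea) (inj _ _ eb).
Qed.

(** A pair whose components dominate only related atoms is a pair of joins of
    nonempty sets of atoms, so closure under joins puts it into the tensor. *)
Lemma restrict_to_atomsK : cancel restrict_to_atoms tensor_from_atoms.
Proof.
move=> T; have [Tn Td TJ] := check_tensorP T.
apply/val_inj/seteqP; split=> -[x y] /=; last first.
  move=> Txy; have [/= x0 y0] := Tn _ Txy; split=> // a b /= ax by_.
  apply: (Td _ _ _ _ Txy _ _ ax by_).
    by have [] := svalP a.
  by have [] := svalP b.
move=> [/= x0 y0 Txy].
have joinE (z : B) : z = bigjoin [set a | atom a /\ a <= z].
  apply/le_anti/andP; split; last by apply/bigjoin_leP => a [].
  apply: le_atoms => a aat az.
  exact: le_bigjoin.
rewrite (joinE x) (joinE y); apply: TJ.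
- by have [a aat ax] := atomistic_atomic x0; exists a.
- by have [a aat ay] := atomistic_atomic y0; exists a.
- by move=> a [[]].
- by move=> a [[]].
- move=> [a b] [[/= aat ax] [bat by_]].
  exact: (Txy (exist _ a aat) (exist _ b bat)).
Qed.

Lemma restrict_to_atoms_le (R T : check_tensor B) :
  (restrict_to_atoms R <= restrict_to_atoms T) = (R <= T).
Proof.
apply/idP/idP => [/asboolP RT|/check_tensor_leP RT]; last first.
  by apply/asboolP => p; exact: RT.
apply/check_tensor_leP; rewrite -(restrict_to_atomsK R) -(restrict_to_atomsK T).
move=> p [p1 p2 Rp]; split=> // a b ap bp.
by have := RT _ (Rp a b ap bp).
Qed.

(** The product of restrictions, extended to [B], is a tensor containing the
    relation product, since the intermediate element of the relation product
    dominates an atom; so it contains the product of the tensors. *)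
Lemma restrict_to_atoms_mul (R T : check_tensor B) :
  restrict_to_atoms (check_mul R T) =
  relprod (restrict_to_atoms R) (restrict_to_atoms T).
Proof.
have [RT_sub RT_least] := check_mul_least R T.
have [Rn Rd _] := check_tensorP R; have [Tn Td _] := check_tensorP T.
apply/seteqP; split=> -[a c]; last first.
  move=> /relprodE [b [ab bc]]; apply: RT_sub; apply/relprodE.
  by exists (sval b).
set RT := relprod (restrict_to_atoms R) _.
suff /RT_least /asboolP RT_le : relprod R T `<=` tensor_from_atoms RT.
  by move=> /RT_le RTac; rewrite -(tensor_from_atomsK RT).
move=> [x z] /relprodE [y [Rxy Tyz]].
have [/= x0 y0] := Rn _ Rxy; have [/= _ z0] := Tn _ Tyz.
split=> // a' c' /= ax cz; apply/relprodE.
have [b bat by_] := atomistic_atomic y0; have [b0 _] := bat.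
have [a0 _] := svalP a'; have [c0 _] := svalP c'.
by exists (exist _ b bat); split; [exact: Rd Rxy a0 b0 ax by_|exact: Td Tyz b0 c0 by_ cz].
Qed.

Lemma restrict_to_atoms_iso :
  quantale_iso (@check_mul d B) (@relprod {a : B | atom a}) restrict_to_atoms.
Proof.
split; [|exact: restrict_to_atoms_le|exact: restrict_to_atoms_mul].
exists tensor_from_atoms; first exact: restrict_to_atomsK.
exact: tensor_from_atomsK.
Qed.

End AtomisticPseudocomplemented.

End Atoms.

(** * Rectangles *)

Section Rectangles.
Context {d : Order.disp_t} {B : completeLatticeType d}.
Implicit Types (x y z : B) (T : check_tensor B).

Definition rect_set x y : set (B * B) :=
  [set p | [/\ nonbot p.1, nonbot p.2, p.1 <= x & p.2 <= y]].

Lemma rect_is_check_tensor x y : is_check_tensor (rect_set x y).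
Proof.
split=> [p []//|u v u' v' [/= _ _ ux vy] u0 v0 uu vv|X Y X0 Y0 Xn Yn XY].
  by split=> //=; [exact: le_trans uu ux|exact: le_trans vv vy].
have [u0 Xu0] := X0; have [v0 Yv0] := Y0.
split=> /=; [exact: bigjoin_nonbot..| |].
  by apply/bigjoin_leP => u Xu; have [] := XY (u, v0) (conj Xu Yv0).
by apply/bigjoin_leP => v Yv; have [] := XY (u0, v) (conj Xu0 Yv).
Qed.

Definition rect x y : check_tensor B :=
  CheckTensor (asboolT (@rect_is_check_tensor x y)).

Lemma rect_le x y T : nonbot x -> nonbot y -> check_tensor_val T (x, y) -> rect x y <= T.
Proof.
move=> x0 y0 Txy; have [_ Td _] := check_tensorP T.
by apply/check_tensor_leP => -[u v] [/= u0 v0 ux vy]; exact: Td Txy _ _ _ _.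
Qed.

Lemma nonbot_top x : nonbot x -> nonbot (\top : B).
Proof. by move=> /nonbot_le; apply; exact: lex1. Qed.

Section Unit.
Variable E : check_tensor B.
Hypothesis mulE1 : left_id E (@check_mul d B).
Hypothesis mul1E : right_id E (@check_mul d B).

(** If [(x, y)] is in [E], then [E * rect y \top = rect y \top] contains
    [(x, \top)], so [x <= y], and [rect \top x * E = rect \top x] contains
    [(\top, y)], so [y <= x]. *)
Lemma unit_diagonal x y : check_tensor_val E (x, y) -> x = y.
Proof.
move=> Exy; have [En _ _] := check_tensorP E; have [/= x0 y0] := En _ Exy.
have t0 := nonbot_top x0; apply/le_anti/andP; split.
  have [+ _] := check_mul_least E (rect y \top); rewrite mulE1.
  have /[swap]/[apply] : relprod E (rect y \top) (x, \top).
    by apply/relprodE; exists y.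
  by case.
have [+ _] := check_mul_least (rect \top x) E; rewrite mul1E.
have /[swap]/[apply] : relprod (rect \top x) E (\top, y).
  by apply/relprodE; exists x.
by case.
Qed.

Lemma unit_atom x : check_tensor_val E (x, x) -> atom x.
Proof.
move=> Exx; have [En Ed _] := check_tensorP E; have [/= x0 _] := En _ Exx.
split=> // y y0 yx; exact: unit_diagonal (Ed _ _ _ _ Exx y0 x0 yx (lexx _)).
Qed.

(** With [A] the set of all [a <= x] such that [(a, a)] is in [E], the tensor
    [E * rect x \top = rect x \top] is contained in [rect (bigjoin A) \top]. *)
Lemma unit_atomistic : atomistic B.
Proof.
move=> x; pose A := [set a | a <= x /\ check_tensor_val E (a, a)].
exists A; first by move=> a [_ /unit_atom].
apply/le_anti/andP; split; last by apply/bigjoin_leP => a [].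
have [->|x0] := nonbotP x; first exact: le0x.
have t0 := nonbot_top x0; have [En _ _] := check_tensorP E.
have [_ /(_ (rect (bigjoin A) \top))] := check_mul_least E (rect x \top).
rewrite mulE1 => le_rect.
suff /le_rect /asboolP /(_ (x, \top)) :
    relprod E (rect x \top) `<=` rect (bigjoin A) \top.
  by case.
move=> [a c] /relprodE [b [Eab [/= b0 c0 bx _]]].
have ab := unit_diagonal Eab; rewrite -ab in Eab b0 bx.
by split=> //=; exact: le_bigjoin.
Qed.

End Unit.

(** All products of [rect \top x] with [rect z \top], for [z] disjoint from
    [x], are contained in [rect \bot \bot], the empty tensor; by
    distributivity, so is the product with [rect (bigjoin Z) \top]. *)
Lemma quantale_pseudocomplemented :
  quantale (@check_mul d B) -> pseudocomplemented B.
Proof.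
move=> [_ _ mulDr _] x.
have [->|x0] := nonbotP x.
  by exists \top => [|z _]; [exact: meet0x|exact: lex1].
pose Z := [set z : B | nonbot z /\ (x `&` z)%O = \bot].
exists (bigjoin Z); last first.
  move=> z xz0; have [->|z0] := nonbotP z; first exact: le0x.
  exact: le_bigjoin.
have [->|/set0P Z0] := eqVneq Z set0; first by rewrite bigjoin0 meetx0.
have t0 := nonbot_top x0; have Zn : Z `<=` @nonbot d B by move=> z [].
have ZJ0 := bigjoin_nonbot Z0 Zn.
have supZ : supremums [set rect z \top | z in Z] (rect (bigjoin Z) \top).
  split=> [_ [z Zz <-]|T TZ].
    apply: rect_le => //; first exact: Zn.
    by split=> //; [exact: Zn|exact: le_bigjoin].
  apply: rect_le => //; rewrite -(bigjoin1 \top).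
  have [_ _ TJ] := check_tensorP T.
  apply: TJ => //; [by exists \top|by move=> _ ->|].
  move=> [z t] [/= Zz ->].
  have /check_tensor_leP : rect z \top <= T by apply: TZ; exists z.
  by apply; split=> //; exact: Zn.
have [_ /(_ (rect \bot \bot))] := mulDr (rect \top x) _ _ supZ.
case: (nonbotP (x `&` bigjoin Z)%O) => // xZ0 le_bot.
have /le_bot /asboolP /(_ (\top, \top)) :
    ubound [set check_mul (rect \top x) S | S in [set rect z \top | z in Z]]
           (rect \bot \bot).
  move=> _ [_ [z [z0 xz0] <-] <-].
  have [_ least] := check_mul_least (rect \top x) (rect z \top).
  apply: least => -[u w] /relprodE [v [[/= u0 v0 _ vx] [/= _ w0 vz _]]].
  by move/negP: v0; rewrite -lex0 -xz0 lexI vx vz.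
case.
  have [mul_sub _] := check_mul_least (rect \top x) (rect (bigjoin Z) \top).
  apply: mul_sub; apply/relprodE; exists (x `&` bigjoin Z)%O.
  by split; split=> //=; rewrite ?leIl ?leIr.
by move=> _ _; rewrite lex0 (negPf t0).
Qed.

Lemma unital_atomistic_pseudocomplemented :
  unital_quantale (@check_mul d B) -> atomistic B /\ pseudocomplemented B.
Proof.
move=> [mulQ [E [mulE1 mul1E]]].
by split; [exact: unit_atomistic mulE1 mul1E|exact: quantale_pseudocomplemented].
Qed.

End Rectangles.

(** * The equivalence *)

Theorem theorem9p1 (d : Order.disp_t) (B : completeLatticeType d) :
  [<-> atomic B /\ boolean B;
       atomistic B /\ pseudocomplemented B;
       [/\ quantale_iso (@tensor_mul d B) (@check_mul d B) (@tensor_to_check d B),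
           quantale_iso (@gal_mul d B) (@check_mul d B) (@gal_to_check d B),
           unital_quantale (@check_mul d B),
           unital_quantale (@tensor_mul d B) &
           unital_quantale (@gal_mul d B)];
       exists (S : Type) (f : check_tensor B -> set (S * S)),
         quantale_iso (@check_mul d B) (@relprod S) f].
Proof.
tfae.
- move=> [at_B bool_B]; split; first exact: atomic_boolean_atomistic.
  exact: boolean_pseudocomplemented.
- move=> [at_B ps_B].
  have check_unital : unital_quantale (@check_mul d B).
    exact: quantale_iso_unital (restrict_to_atoms_iso at_B ps_B)
      relprod_unital_quantale.
  split=> //; [exact: tensor_to_check_iso|exact: gal_to_check_iso| |].
    exact: quantale_iso_unital (tensor_to_check_iso B) check_unital.
  exact: quantale_iso_unital (gal_to_check_iso B) check_unital.
- move=> [_ _ /unital_atomistic_pseudocomplemented [at_B ps_B] _ _].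
  by exists {a : B | atom a}, (@restrict_to_atoms d B);
    exact: restrict_to_atoms_iso.
- move=> [S [f /quantale_iso_unital /(_ relprod_unital_quantale)]].
  move=> /unital_atomistic_pseudocomplemented [at_B ps_B].
  by split; [exact: atomistic_atomic|exact: atomistic_boolean].
Qed.
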